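(* Let $f:[0,+\infty)\to\mathbb R$ be of bounded variation. For all $n,N\in\mathbb N$ with $N\ge n$, $$\sum_{0\le k<N}f(k)=\sum_{0\le k<n}f(k)+\int_n^N f(x)\,dx-\frac12\big(f(N)-f(n)\big)+\varepsilon_1(n,N),$$ where the real number $\varepsilon_1(n,N)$ (defined by this equality) satisfies $$|\varepsilon_1(n,N)|\le\frac12\,\mathrm{pV}(f,[n,N])\le\frac12\,\mathrm{pV}(f,[n,+\infty)).$$
   Context: For a real-valued function $f$ on an interval $I$, the pointwise variation of $f$ on $I$ is $$\mathrm{pV}(f,I):=\sup\Big\{\sum_{0\le i<m}|f(t_{i+1})-f(t_i)|:\ t_i\in I,\ t_0<t_1<\dots<t_m\Big\}$$ (equal to $0$ when $I$ is a single point), and $f$ is of bounded variation on $I$ if $\mathrm{pV}(f,I)<+\infty$. $\mathbb N=\{0,1,2,\dots\}$, and $\sum_{0\le k<n}f(k)$ denotes $\sum_{k=0}^{n-1}f(k)$, with the empty sum equal to $0$. *)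

(* Defs.v *)
From mathcomp Require Import all_boot all_order all_algebra.
From mathcomp Require Import all_classical all_reals all_analysis.
Import Order.TTheory GRing.Theory Num.Theory.
Import numFieldNormedType.Exports.

Set Implicit Arguments.
Unset Strict Implicit.
Unset Printing Implicit Defensive.

Local Open Scope classical_set_scope.
Local Open Scope ring_scope.

(* The library's [total_variation a b f] only covers compact intervals
   [a, b], and an unbounded interval is needed too.  Only t 0, ..., t m
   matter; m = 0 contributes the empty sum 0. *)
Definition pvariation_sums (R : realType) (f : R -> R) (I : set R) : set R :=
  [set x | exists (m : nat) (t : nat -> R),
    [/\ forall i, (i <= m)%N -> I (t i),
        forall i, (i < m)%N -> t i < t i.+1 &
        x = \sum_(0 <= i < m) `|f (t i.+1) - f (t i)| ]].

Definition pV (R : realType) (f : R -> R) (I : set R) : \bar R :=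
  ereal_sup [set x%:E | x in pvariation_sums f I].

Definition is_bounded_variation (R : realType) (f : R -> R) (I : set R) : Prop :=
  (pV f I < +oo)%E.

Lemma pV_set1 (R : realType) (f : R -> R) (a : R) : pV f [set a] = 0%E.
Proof.
rewrite /pV (_ : pvariation_sums f [set a] = [set 0]) ?image_set1 ?ereal_sup1//.
apply/seteqP; split => [x [m [t [tI tlt ->]]]|_ ->] /=.
  rewrite big_nat big1// => i /andP[_ im].
  by rewrite (tI i.+1 im) (tI i (ltnW im)) subrr normr0.
by exists 0%N, (fun=> a); split => //; rewrite big_geq.
Qed.

(* Main.v *)
Require Import Defs.
From mathcomp Require Import all_boot all_order all_algebra.
From mathcomp Require Import all_classical all_reals all_analysis.
From mathcomp Require Import measurable_realfun ring lra.
Import Order.TTheory GRing.Theory Num.Theory.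
Import numFieldNormedType.Exports.
Local Open Scope classical_set_scope.
Local Open Scope ring_scope.

(* On an interval [a, b] every value f x satisfies
   |(f a + f b) / 2 - f x| <= (|f x - f a| + |f b - f x|) / 2 <= V / 2, where V
   is the variation of f on [a, b]; integrating bounds the error of the
   trapezoidal rule.  Applied on each [k, k + 1], the errors add up because
   the variation is additive, and the sum of the trapezoids
   (f k + f (k + 1)) / 2 differs from the sum of the f k by the telescoping
   term (f N - f n) / 2. *)

(** Bridge to the library's variation: upper bounds by [total_variation] become bounds by [pV], and
    finiteness of [pV] on [I] passes to compact subintervals. *)
Lemma total_variation_le_pV (R : realType) (f : R -> R) (a b : R) (I : set R) :
  a <= b -> `[a, b] `<=` I -> (total_variation a b f <= pV f I)%E.
Proof.
move=> ab abI; apply: ge_ereal_sup => _ [_ [s abs <-] <-].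
apply: ereal_sup_ubound; exists (variation a b f s) => //.
(* A partition [s] lists the nodes after [a], so [a :: s] restores all [size s + 1] of them. *)
exists (size s), (nth b (a :: s)); split => //.
- move=> i si; apply: abI; rewrite /= in_itv /=.
  by rewrite itv_partition_nth_ge ?itv_partition_nth_le.
- by move=> i si; case: abs => /(pathP b) + _; exact.
Qed.

Lemma le_pV (R : realType) (f : R -> R) (I J : set R) :
  I `<=` J -> (pV f I <= pV f J)%E.
Proof.
move=> IJ; apply/ereal_sup_le/image_subset => x [m [t [tI tlt ->]]].
by exists m, t; split => // i im; exact/IJ/tI.
Qed.

Lemma pV_bounded_variation (R : realType) (f : R -> R) (a b : R) (I : set R) :
  a <= b -> `[a, b] `<=` I -> is_bounded_variation f I ->
  bounded_variation a b f.
Proof.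
move=> ab abI fI; apply/bounded_variationP => //.
rewrite ge0_fin_numE ?total_variation_ge0//.
exact: le_lt_trans (total_variation_le_pV _ _ _ _ _ ab abI) fI.
Qed.

(** Precomposing with the clamp onto [[a, b]] gives a function that is monotone on the whole line
    and agrees with [g] on the interval. *)
Lemma nondecreasing_on_measurable (R : realType) (a b : R) (g : R -> R) :
  a <= b -> {in `[a, b] &, nondecreasing_fun g} -> measurable_fun `[a, b] g.
Proof.
move=> ab g_nd; pose clamp x := Num.max a (Num.min x b).
have clamp_itv x : clamp x \in `[a, b].
  by rewrite in_itv /= le_max lexx ge_max ab ge_min lexx orbT.
apply: (eq_measurable_fun (g \o clamp)) => [x /set_mem /=|].
  by rewrite in_itv /= /clamp => /andP[ax xb]; rewrite (min_l xb) (max_r ax).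
apply: nondecreasing_measurable => // x y xy /=; apply: g_nd => //.
by rewrite /clamp le_max2 // le_min2.
Qed.

Lemma half_sum_sub_le (R : realType) (a b x : R) (f : R -> R) :
  a <= x -> x <= b -> bounded_variation a b f ->
  `|2^-1 * (f a + f b) - f x| <= 2^-1 * fine (total_variation a b f).
Proof.
move=> ax xb fBV; have ab := le_trans ax xb.
have axfin : total_variation a x f \is a fin_num.
  exact/bounded_variationP/(bounded_variationl ax xb).
have xbfin : total_variation x b f \is a fin_num.
  exact/bounded_variationP/(bounded_variationr ax xb).
rewrite (total_variationD f ax xb) fineD//.
have : `|f x - f a| <= fine (total_variation a x f).
  by rewrite -lee_fin fineK // total_variation_ge.
have : `|f b - f x| <= fine (total_variation x b f).
  by rewrite -lee_fin fineK // total_variation_ge.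
rewrite !ler_norml; lra.
Qed.

Lemma bounded_variation_integrable (R : realType) (a b : R) (f : R -> R) :
  a <= b -> bounded_variation a b f ->
  (@lebesgue_measure R).-integrable `[a, b] (EFin \o f).
Proof.
move=> ab fBV; apply: measurable_bounded_integrable => //.
- by rewrite /= lebesgue_measure_itv /=; case: ifP => _; rewrite -?EFinB ltry.
(* Jordan decomposition: [f] is a difference of two nondecreasing functions. As [pos_tv a f] is
   [neg_tv a (\- f)], one monotonicity lemma serves both. *)
- apply: (eq_measurable_fun ((fine \o pos_tv a f) \- (fine \o neg_tv a f))).
    by move=> x /set_mem xab; rewrite (bounded_variation_pos_neg_tvE fBV).
  apply: measurable_funB; apply: nondecreasing_on_measurable => //;
    apply: fine_neg_tv_nondecreasing => //.
  exact/bounded_variationN.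
(* On [[a, b]], [f] stays within half the variation of the endpoint mean. *)
- exists (`|2^-1 * (f a + f b)| + 2^-1 * fine (total_variation a b f)).
  split; first exact: num_real.
  move=> M /ltW fM x /=; rewrite in_itv /= => /andP[ax xb].
  apply: le_trans fM; have := half_sum_sub_le R a b x f ax xb fBV.
  rewrite distrC => /(lerD (lexx `|2^-1 * (f a + f b)|)); apply: le_trans.
  by rewrite -{1}(subrK (2^-1 * (f a + f b)) (f x)) addrC ler_normD.
Qed.

Lemma trapezoid_error_le (R : realType) (a b : R) (f : R -> R) :
  a <= b -> bounded_variation a b f ->
  `|(b - a) * (2^-1 * (f a + f b)) - \int[@lebesgue_measure R]_(x in `[a, b]) f x|
    <= (b - a) * (2^-1 * fine (total_variation a b f)).
Proof.
move=> ab fBV; set c := 2^-1 * _; set v := 2^-1 * _.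
have fint := bounded_variation_integrable R a b f ab fBV.
have kint (r : R) : (@lebesgue_measure R).-integrable `[a, b] (EFin \o cst r).
  apply: measurable_bounded_integrable => //.
    by rewrite /= lebesgue_measure_itv /=; case: ifP => _; rewrite -?EFinB ltry.
  exact: bounded_cst.
have intc r : \int[@lebesgue_measure R]_(x in `[a, b]) r = (b - a) * r.
  rewrite Rintegral_cst //= lebesgue_measure_itv /= lte_fin mulrC.
  by case: ltgtP ab => // ->; rewrite subrr.
have dint : (@lebesgue_measure R).-integrable `[a, b] (EFin \o (cst c \- f)).
  by apply: eq_integrable (integrableB _ (kint c) fint).
(* Writing both multiples of [b - a] as integrals of constants reduces the claim to the pointwise
   bound [half_sum_sub_le]. *)
rewrite -!intc -RintegralB //; last exact: kint.
apply: le_trans (le_normr_Rintegral _ dint) _ => //.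
apply: le_Rintegral => //; [exact: (integrable_norm dint)|exact: kint|].
by move=> x /=; rewrite in_itv /= => /andP[ax xb]; exact: half_sum_sub_le.
Qed.

Lemma sum_integral_error_le (R : realType) (f : R -> R) (n d : nat) :
  bounded_variation n%:R (n + d)%:R f ->
  `|\sum_(n <= k < n + d) f k%:R
     - \int[@lebesgue_measure R]_(x in `[n%:R, (n + d)%:R]) f x
     + 2^-1 * (f (n + d)%:R - f n%:R)|
  <= 2^-1 * fine (total_variation n%:R (n + d)%:R f).
Proof.
elim: d => [|d IH].
  rewrite addn0 big_geq // set_itv1 Rintegral_set1 !subrr mulr0 addr0.
  by rewrite normr0 total_variationxx mulr0.
rewrite addnS; set m := (n + d)%N => fBV.
have nm : n%:R <= m%:R :> R by rewrite ler_nat leq_addr.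
have mS : m%:R <= m.+1%:R :> R by rewrite ler_nat.
have BVl := bounded_variationl nm mS fBV.
have BVr := bounded_variationr nm mS fBV.
have := trapezoid_error_le R _ _ f mS BVr; have := IH BVl.
rewrite -/m (total_variationD f nm mS) fineD; last 2 first.
- exact/bounded_variationP.
- exact/bounded_variationP.
have fint := bounded_variation_integrable R _ _ f (le_trans nm mS) fBV.
have := Rintegral_itvB fint (_ : BLeft n%:R <= BRight m%:R)%O (_ : BRight m%:R <= BRight m.+1%:R)%O.
rewrite !bnd_simp => /(_ nm mS).
(* Splitting the integral at [m] leaves the half-open interval from [m] to [m.+1]; adding the point
   [m] back does not change the integral. *)
rewrite Rintegral_itv_obnd_cbnd; last first.
  by apply: integrableS fint => //; apply: subset_itvr; rewrite bnd_simp.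
rewrite big_nat_recr ?leq_addr //=.
have -> : m.+1%:R - m%:R = 1 :> R by rewrite -natrB // subSnn.
rewrite !mul1r.
move: (\int[_]_(x in _) _) (\int[_]_(x in _) _) (\int[_]_(x in _) _) => p q r.
move: (fine _) (fine _) (\sum_(_ <= _ < _) _) => u v s.
(* The new error is the old one plus the trapezoid error on the last unit interval, because [f m +
   (f (m + 1) - f m) / 2 = (f m + f (m + 1)) / 2]. *)
rewrite !ler_norml; lra.
Qed.

Theorem corollary2p3 (R : realType) (f : R -> R)
    (hf : is_bounded_variation f `[0, +oo[) (n N : nat) (hnN : (n <= N)%N) :
  (@lebesgue_measure R).-integrable `[n%:R, N%:R] (EFin \o f) /\
  exists eps1 : R,
    [/\ \sum_(0 <= k < N) f k%:R =
          \sum_(0 <= k < n) f k%:R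
          + \int[@lebesgue_measure R]_(x in `[n%:R, N%:R]) f x
          - 2^-1 * (f N%:R - f n%:R) + eps1,
        (`|eps1|%:E <= 2^-1%:E * pV f `[n%:R, N%:R])%E &
        (2^-1%:E * pV f `[n%:R, N%:R] <= 2^-1%:E * pV f `[n%:R, +oo[)%E].
Proof.
have nN : n%:R <= N%:R :> R by rewrite ler_nat.
have nNI : `[n%:R, N%:R] `<=` (`[0, +oo[ : set R).
  by move=> x /=; rewrite !in_itv /= andbT => /andP[nx _]; exact: le_trans nx.
have fBV := pV_bounded_variation _ _ _ _ _ nN nNI hf.
(* The integral operator returns a real for any function, so integrability certifies that its value
   is meaningful. *)
split; first exact: bounded_variation_integrable.
(* The only possible witness: the required equality solved for [eps1]. *)
exists (\sum_(n <= k < N) f k%:R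
     - \int[@lebesgue_measure R]_(x in `[n%:R, N%:R]) f x
     + 2^-1 * (f N%:R - f n%:R)); split.
- rewrite (big_cat_nat (leq0n n) hnN) /=; ring.
- have := sum_integral_error_le R f n (N - n).
  rewrite subnKC // => /(_ fBV); rewrite -lee_fin => /le_trans; apply.
  rewrite EFinM fineK; last exact/bounded_variationP.
  by rewrite lee_pmul2l //; exact: total_variation_le_pV.
- rewrite lee_pmul2l //; apply: le_pV => x /=.
  by rewrite !in_itv /= andbT => /andP[].
Qed.
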